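(* Let $F_2=\langle u,v\rangle$ be the free group on two generators, let $B_3=\langle a,b\mid aba=bab\rangle$ with $s:=aba=bab$, regarded as a subgroup of $\mathrm{Aut}(F_2)$ via the representation in which $a$ acts by $u\mapsto u,\ v\mapsto u^{-1}v$ and $b$ acts by $u\mapsto vu,\ v\mapsto v$. Then the subgroup $\mathrm{Int}(F_2)$ of inner automorphisms: - intersects $B_3$ in the subgroup of index two of the center of $B_3$: $\mathrm{Int}(F_2)\cap B_3=\langle s^4\rangle$; - is the kernel of $\rho^+:\mathrm{Aut}^+(F_2)\to SL(2,\mathbb{Z})$; - generates, together with $B_3$, the group of direct automorphisms: $\mathrm{Aut}^+(F_2)=\mathrm{Int}(F_2)\,B_3$.
   Context: The abelianization $F_2\to\mathbb{Z}^2$ (with $u\mapsto e_1$, $v\mapsto e_2$) induces a morphism $\rho:\mathrm{Aut}(F_2)\to GL(2,\mathbb{Z})$. The group of direct automorphisms is $\mathrm{Aut}^+(F_2):=\rho^{-1}(SL(2,\mathbb{Z}))$, and $\rho^+:\mathrm{Aut}^+(F_2)\to SL(2,\mathbb{Z})$ is the restriction of $\rho$. $B_3$ is Artin's braid group on three strings, whose center is $Z=\langle s^2\rangle$, $s^2=ababab$. The action on $F_2=\langle u,v\rangle$ in which $a$ acts by $u\mapsto u,\ v\mapsto u^{-1}v$ and $b$ acts by $u\mapsto vu,\ v\mapsto v$ defines an injective morphism $B_3\to\mathrm{Aut}(F_2)$ (product in $\mathrm{Aut}(F_2)$ is composition of maps), by which $B_3$ is identified with a subgroup of $\mathrm{Aut}(F_2)$.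 $\mathrm{Int}(F_2)$ is the normal subgroup of inner automorphisms. *)

(* Defs.v *)
From HB Require Import structures.
From mathcomp Require Import all_boot all_algebra.
From mathcomp Require Import boolp classical_sets cardinality.

Set Implicit Arguments.
Unset Strict Implicit.
Unset Printing Implicit Defensive.

Import GRing.Theory.

Local Open Scope classical_set_scope.
Local Open Scope card_scope.
Local Open Scope group_scope.
Local Open Scope quotient_scope.

(* presented R is <X | R>: words in the letters x = (x, true) and x^-1 = (x, false),
   modulo the least congruence that contains R and cancels x x^-1 and x^-1 x.
   The free group on X is the case where R is empty. *)
Section Presentation.
Variable X : choiceType.

Definition word : Type := seq (X * bool).

Variable R : word -> word -> Prop.

Inductive word_eq : word -> word -> Prop :=
| WordRefl w : word_eq w w
| WordSym w1 w2 : word_eq w1 w2 -> word_eq w2 w1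
| WordTrans w1 w2 w3 : word_eq w1 w2 -> word_eq w2 w3 -> word_eq w1 w3
| WordCat w1 w2 w1' w2' :
    word_eq w1 w1' -> word_eq w2 w2' -> word_eq (w1 ++ w2) (w1' ++ w2')
| WordCancel x b : word_eq [:: (x, b); (x, ~~ b)] [::]
| WordRel w1 w2 : R w1 w2 -> word_eq w1 w2.

Definition word_eqb : rel (seq (X * bool)) := fun w1 w2 => `[< word_eq w1 w2 >].

Lemma word_eqb_refl : reflexive word_eqb.
Proof. by move=> w; apply/asboolP/WordRefl. Qed.

Lemma word_eqb_sym : symmetric word_eqb.
Proof. by move=> w1 w2; apply/asboolP/asboolP => /WordSym. Qed.

Lemma word_eqb_trans : transitive word_eqb.
Proof.
by move=> w2 w1 w3 /asboolP h12 /asboolP h23; apply/asboolP/(WordTrans h12 h23).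
Qed.

Canonical word_equiv :=
  EquivRel word_eqb word_eqb_refl word_eqb_sym word_eqb_trans.

Definition presented : Type := {eq_quot word_equiv}.

HB.instance Definition _ := Choice.on presented.
HB.instance Definition _ := Quotient.on presented.

Definition class_of (w : word) : presented := \pi_presented w.

Lemma class_ofP w1 w2 : class_of w1 = class_of w2 <-> word_eq w1 w2.
Proof.
split=> [/eqmodP /asboolP //|h]; exact/eqmodP/asboolP.
Qed.

Lemma class_of_repr (g : presented) : class_of (repr g) = g.
Proof. exact: reprK. Qed.

Lemma word_eq_repr w : word_eq (repr (class_of w)) w.
Proof. by apply/class_ofP; rewrite class_of_repr. Qed.

Definition word_inv (w : word) : word := rev [seq (l.1, ~~ l.2) | l <- w].

Lemma word_invK : involutive word_inv.
Proof.
move=> w; rewrite /word_inv map_rev revK -map_comp map_id_in // => -[x b] _ /=.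
by rewrite negbK.
Qed.

Lemma word_inv_cat w1 w2 : word_inv (w1 ++ w2) = word_inv w2 ++ word_inv w1.
Proof. by rewrite /word_inv map_cat rev_cat. Qed.

Lemma word_invr w : word_eq (w ++ word_inv w) [::].
Proof.
elim: w => [|[x b] w IHw]; first exact: WordRefl.
rewrite -cat1s word_inv_cat -!catA (catA w).
apply: (WordTrans _ (WordCancel x b)).
rewrite -[X in word_eq _ X]/([:: (x, b)] ++ ([::] ++ [:: (x, ~~ b)])).
by do 2?[apply: WordCat => //]; apply: WordRefl.
Qed.

Lemma word_invl w : word_eq (word_inv w ++ w) [::].
Proof. by rewrite -{2}[w]word_invK; apply: word_invr. Qed.

Lemma word_eq_inv w1 w2 : word_eq w1 w2 -> word_eq (word_inv w1) (word_inv w2).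
Proof.
move=> h; have refl := WordRefl.
have e1 : word_eq (word_inv w1) (word_inv w1 ++ (w2 ++ word_inv w2)).
  rewrite -{1}[word_inv w1]cats0; apply: WordCat => //.
  exact/WordSym/word_invr.
have e2 : word_eq (word_inv w1 ++ (w2 ++ word_inv w2))
                  ((word_inv w1 ++ w1) ++ word_inv w2).
  by rewrite catA; do 2!apply: WordCat => //; apply: WordSym.
apply: (WordTrans e1); apply: (WordTrans e2).
rewrite -[X in word_eq _ X]cat0s; apply: WordCat => //; exact: word_invl.
Qed.

Definition pmul (g h : presented) : presented := class_of (repr g ++ repr h).
Definition pinv (g : presented) : presented := class_of (word_inv (repr g)).

Lemma pmulE w1 w2 : pmul (class_of w1) (class_of w2) = class_of (w1 ++ w2).
Proof. by apply/class_ofP/WordCat; apply: word_eq_repr. Qed.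

Lemma pinvE w : pinv (class_of w) = class_of (word_inv w).
Proof. exact/class_ofP/word_eq_inv/word_eq_repr. Qed.

Lemma pmulA : associative pmul.
Proof.
move=> g h k; rewrite -[g]class_of_repr -[h]class_of_repr -[k]class_of_repr.
by rewrite !pmulE catA.
Qed.

Lemma pmul1g : left_id (class_of [::]) pmul.
Proof. by move=> g; rewrite -[g]class_of_repr pmulE. Qed.

Lemma pmulg1 : right_id (class_of [::]) pmul.
Proof. by move=> g; rewrite -[g]class_of_repr pmulE cats0. Qed.

Lemma pmulVg : left_inverse (class_of [::]) pinv pmul.
Proof.
move=> g; rewrite -[g]class_of_repr pinvE pmulE.
exact/class_ofP/word_invl.
Qed.

Lemma pmulgV : right_inverse (class_of [::]) pinv pmul.
Proof.
move=> g; rewrite -[g]class_of_repr pinvE pmulE.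
exact/class_ofP/word_invr.
Qed.

HB.instance Definition _ :=
  isGroup.Build presented pmulA pmul1g pmulg1 pmulVg pmulgV.

Lemma class_ofM w1 w2 : class_of w1 * class_of w2 = class_of (w1 ++ w2).
Proof. exact: pmulE. Qed.

Definition pgen (x : X) : presented := class_of [:: (x, true)].

Section Lift.
Variables (H : groupType) (h : X -> H).

Definition word_eval (w : word) : H :=
  \prod_(l <- w) (if l.2 then h l.1 else (h l.1)^-1).

Lemma word_eval_cat w1 w2 : word_eval (w1 ++ w2) = word_eval w1 * word_eval w2.
Proof. by rewrite /word_eval big_cat. Qed.

Hypothesis hR : forall w1 w2, R w1 w2 -> word_eval w1 = word_eval w2.

Lemma word_eval_eq w1 w2 : word_eq w1 w2 -> word_eval w1 = word_eval w2.
Proof.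
elim=> // {w1 w2} [w1 w2 w3 _ -> _ -> //|w1 w2 w1' w2' _ e1 _ e2|x b].
  by rewrite !word_eval_cat e1 e2.
rewrite /word_eval big_nil big_cons big_seq1 /=.
by case: b => /=; rewrite ?mulgV ?mulVg.
Qed.

(* The morphism <X | R> -> H that sends each generator x to h x. *)
Definition plift (_ : forall w1 w2, R w1 w2 -> word_eval w1 = word_eval w2)
  (g : presented) : H := word_eval (repr g).

Lemma plift_class w : plift hR (class_of w) = word_eval w.
Proof. exact/word_eval_eq/word_eq_repr. Qed.

Lemma plift_gen x : plift hR (pgen x) = h x.
Proof. by rewrite plift_class /word_eval big_seq1. Qed.

Lemma pliftM : {morph plift hR : g k / g * k}.
Proof.
move=> g k; rewrite -[g]class_of_repr -[k]class_of_repr.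
by rewrite [_ * _]pmulE !plift_class word_eval_cat.
Qed.

Lemma plift1 : plift hR 1 = 1.
Proof. by rewrite plift_class /word_eval big_nil. Qed.

End Lift.

Lemma morph_gen_eq (H : groupType) (f k : presented -> H) :
    {morph f : x y / x * y} -> {morph k : x y / x * y} ->
  (forall x, f (pgen x) = k (pgen x)) -> f =1 k.
Proof.
move=> fM kM fk.
have m1 (m : presented -> H) : {morph m : x y / x * y} -> m 1 = 1.
  by move=> mM; apply: (mulgI (m 1)); rewrite -mM !mulg1.
have mV (m : presented -> H) : {morph m : x y / x * y} ->
    forall x, m x^-1 = (m x)^-1.
  by move=> mM x; apply: (mulgI (m x)); rewrite -mM !mulgV m1.
move=> g; rewrite -[g]class_of_repr; elim: (repr g) => [|[x b] w IHw].
  by rewrite -[class_of [::]]/(1 : presented) !m1.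
rewrite -cat1s -pmulE fM kM IHw; congr (_ * _).
have := fk x; case: b => // e.
by rewrite -[class_of _]/(class_of (word_inv [:: (x, true)])) -pinvE !mV ?e.
Qed.

End Presentation.

HB.instance Definition _ (X : choiceType) (R : word X -> word X -> Prop)
    (H : groupType) (h : X -> H)
    (hR : forall w1 w2, R w1 w2 -> word_eval h w1 = word_eval h w2) :=
  isUMagmaMorphism.Build (presented R) H (plift hR) (plift1 hR, pliftM hR).

Section Automorphisms.
Variable G : groupType.

(* Under the group law below, the product f * g is the composition f \o g. *)
Record AutGroup : Type := MkAut {
  aut_fun :> G -> G;
  aut_morph : {morph aut_fun : x y / x * y};
  aut_bij : bijective aut_fun }.

Lemma autP (f g : AutGroup) : f =1 g -> f = g.
Proof.
case: f g => [f fM fb] [g gM gb] /= /funext fg; subst g.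
by congr MkAut; apply: Prop_irrelevance.
Qed.

HB.instance Definition _ := gen_eqMixin AutGroup.
HB.instance Definition _ := gen_choiceMixin AutGroup.

Definition aut_one : AutGroup :=
  MkAut (fun _ _ => erefl)
    (Bijective (g := id) (fun _ => erefl) (fun _ => erefl)).

Lemma aut_mul_morph (f g : AutGroup) : {morph (f \o g) : x y / x * y}.
Proof. by move=> x y /=; rewrite !aut_morph. Qed.

Definition aut_mul (f g : AutGroup) : AutGroup :=
  MkAut (@aut_mul_morph f g) (bij_comp (aut_bij f) (aut_bij g)).

Lemma aut_inv_ex (f : AutGroup) : exists g : G -> G, cancel f g /\ cancel g f.
Proof. by case: (aut_bij f) => g fK gK; exists g. Qed.

Definition aut_inv_fun (f : AutGroup) : G -> G := projT1 (cid (aut_inv_ex f)).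

Lemma aut_funK (f : AutGroup) : cancel f (aut_inv_fun f).
Proof. exact: (projT2 (cid (aut_inv_ex f))).1. Qed.

Lemma aut_inv_funK (f : AutGroup) : cancel (aut_inv_fun f) f.
Proof. exact: (projT2 (cid (aut_inv_ex f))).2. Qed.

Lemma aut_inv_morph (f : AutGroup) : {morph aut_inv_fun f : x y / x * y}.
Proof.
move=> x y; apply: (bij_inj (aut_bij f)).
by rewrite aut_morph !aut_inv_funK.
Qed.

Definition aut_inv (f : AutGroup) : AutGroup :=
  MkAut (aut_inv_morph f) (Bijective (aut_inv_funK f) (aut_funK f)).

Lemma aut_mulA : associative aut_mul.
Proof. by move=> f g h; apply: autP. Qed.

Lemma aut_mul1 : left_id aut_one aut_mul.
Proof. by move=> f; apply: autP. Qed.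

Lemma aut_mulr1 : right_id aut_one aut_mul.
Proof. by move=> f; apply: autP. Qed.

Lemma aut_mulV : left_inverse aut_one aut_inv aut_mul.
Proof. by move=> f; apply: autP => x; apply: aut_funK. Qed.

Lemma aut_mulrV : right_inverse aut_one aut_inv aut_mul.
Proof. by move=> f; apply: autP => x; apply: aut_inv_funK. Qed.

HB.instance Definition _ :=
  isGroup.Build AutGroup aut_mulA aut_mul1 aut_mulr1 aut_mulV aut_mulrV.

Lemma aut_mulE (f g : AutGroup) x : (f * g) x = f (g x).
Proof. by []. Qed.

Lemma inner_bij (g : G) : bijective (fun x : G => x ^ g).
Proof. exact: Bijective (conjgK g) (conjgKV g). Qed.

(* x ^ g is g^-1 * x * g. *)
Definition inner (g : G) : AutGroup := MkAut (fun x y => conjMg x y g) (inner_bij g).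

Definition IntAut : set AutGroup := range inner.

End Automorphisms.

Arguments IntAut : clear implicits.

Lemma aut1 (G : groupType) (f : AutGroup G) : f 1 = 1.
Proof. by apply: (mulgI (f 1)); rewrite -aut_morph !mulg1. Qed.

HB.instance Definition _ (G : groupType) (f : AutGroup G) :=
  isUMagmaMorphism.Build G G f (aut1 f, @aut_morph G f).

Section Subgroups.
Variable G : groupType.
Implicit Types A B H K : set G.

Definition is_subgroup H : Prop :=
  [/\ H 1, forall x y, H x -> H y -> H (x * y) & forall x, H x -> H x^-1].

Definition subgroup_gen A : set G := smallest is_subgroup A.

Definition mulset A B : set G := [set x * y | x in A & y in B].

Definition left_coset (x : G) H : set G := [set x * h | h in H].

Definition center_of K : set G := [set z | K z /\ forall x, K x -> commute z x].

Definition index_two_subgroup H K : Prop :=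
  [/\ is_subgroup H, H `<=` K & [set left_coset x H | x in K] #= `I_2].

End Subgroups.

Definition F2 : groupType := presented (fun _ _ : word 'I_2 => False).

Definition F2_u : F2 := pgen _ ord0.
Definition F2_v : F2 := pgen _ ord_max.

Lemma ord2P (i : 'I_2) : i = ord0 \/ i = ord_max.
Proof. by case: i => [[|[|]]] // hi; [left|right]; apply: val_inj. Qed.

Section F2Lift.
Variable H : groupType.

Definition F2_gens (x y : H) : 'I_2 -> H := fun i => if i == ord0 then x else y.

Lemma F2_no_rel (h : 'I_2 -> H) w1 w2 :
  False -> word_eval h w1 = word_eval h w2.
Proof. by []. Qed.

(* The morphism F2 -> H with u |-> x and v |-> y. *)
Definition F2_lift (x y : H) : F2 -> H := plift (@F2_no_rel (F2_gens x y)).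

HB.instance Definition _ x y := UMagmaMorphism.on (F2_lift x y).

Lemma F2_liftM x y : {morph F2_lift x y : g k / g * k}.
Proof. exact: pliftM. Qed.

Lemma F2_lift_u x y : F2_lift x y F2_u = x.
Proof. exact: plift_gen. Qed.

Lemma F2_lift_v x y : F2_lift x y F2_v = y.
Proof. exact: plift_gen. Qed.

Lemma F2_morph_eq (f k : F2 -> H) :
    {morph f : x y / x * y} -> {morph k : x y / x * y} ->
  f F2_u = k F2_u -> f F2_v = k F2_v -> f =1 k.
Proof.
move=> fM kM fku fkv; apply: morph_gen_eq => // i.
by case: (ord2P i) => ->.
Qed.

End F2Lift.

(* The abelianization u |-> e_1, v |-> e_2, with Z^2 as column vectors. *)
Definition abel : F2 -> 'cV[int]_2 :=
  @F2_lift (Algebra.to_multiplicative 'cV[int]_2)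
    (delta_mx ord0 0%R) (delta_mx ord_max 0%R).

Lemma abelM x y : abel (x * y) = (abel x + abel y)%R.
Proof. exact: (@gmulfM _ _ (@F2_lift (Algebra.to_multiplicative 'cV[int]_2) _ _)). Qed.

Lemma abel_gen i : abel (pgen _ i) = delta_mx i 0%R.
Proof.
pose V : groupType := Algebra.to_multiplicative 'cV[int]_2.
by case: (ord2P i) => ->; [exact: (@F2_lift_u V) | exact: (@F2_lift_v V)].
Qed.

(* The j-th column of rho f is the class of the image of the j-th generator:
   matrices act on columns, so that rho turns composition into *m. *)
Definition rho (f : AutGroup F2) : 'M[int]_2 :=
  \matrix_(i, j) abel (f (pgen _ j)) i 0%R.

Lemma rho_abel (f : AutGroup F2) (x : F2) : abel (f x) = (rho f *m abel x)%R.
Proof.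
have gen j : abel (f (pgen _ j)) = (rho f *m abel (pgen _ j))%R.
  rewrite abel_gen; apply/matrixP => i k.
  by rewrite (ord1 k) -colE !mxE.
apply: (@F2_morph_eq (Algebra.to_multiplicative 'cV[int]_2)
  (abel \o f) (fun x => (rho f *m abel x)%R)) => [y z|y z||] /=.
- by rewrite gmulfM abelM.
- by rewrite abelM mulmxDr.
- exact: gen.
- exact: gen.
Qed.

Lemma rhoM (f g : AutGroup F2) : rho (f * g) = (rho f *m rho g)%R.
Proof.
apply/matrixP => i j; rewrite mxE aut_mulE rho_abel !mxE.
by apply: eq_bigr => k _; rewrite !mxE.
Qed.

Lemma rho1 : rho 1 = 1%:M%R.
Proof. by apply/matrixP => i j; rewrite mxE abel_gen !mxE andbT. Qed.

Lemma rho_unitmx (f : AutGroup F2) : rho f \in unitmx.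
Proof.
by have [] // := mulmx1_unit (A := rho f) (B := rho f^-1); rewrite -rhoM mulgV rho1.
Qed.

Definition SL2Z : set 'M[int]_2 := [set M | (\det M = 1)%R].

Definition AutPlus : set (AutGroup F2) := rho @^-1` SL2Z.

Definition ker_rho_plus : set (AutGroup F2) := [set f | AutPlus f /\ rho f = 1%:M%R].

Definition braid_rel (w1 w2 : word 'I_2) : Prop :=
  let la := (ord0 : 'I_2, true) in let lb := (ord_max : 'I_2, true) in
  w1 = [:: la; lb; la] /\ w2 = [:: lb; la; lb].

Definition B3 : groupType := presented braid_rel.

Definition B3_a : B3 := pgen _ ord0.
Definition B3_b : B3 := pgen _ ord_max.
Definition B3_s : B3 := B3_a * B3_b * B3_a.

Lemma s_alt : B3_s = B3_b * B3_a * B3_b.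
Proof.
rewrite /B3_s /B3_a /B3_b /pgen [X in X * _ = _]class_ofM [X in _ = X * _]class_ofM.
rewrite [LHS]class_ofM [RHS]class_ofM.
by apply/class_ofP/WordRel; split.
Qed.

Definition act_a_fun : F2 -> F2 := F2_lift F2_u (F2_u^-1 * F2_v).
Definition act_b_fun : F2 -> F2 := F2_lift (F2_v * F2_u) F2_v.

Lemma F2_endoK (x y x' y' : F2) :
    F2_lift x' y' x = F2_u -> F2_lift x' y' y = F2_v ->
  cancel (F2_lift x y) (F2_lift x' y').
Proof.
move=> xu yv; apply: (@F2_morph_eq F2 (F2_lift x' y' \o F2_lift x y) id) => //=.
- by move=> z t; rewrite !gmulfM.
- by rewrite F2_lift_u.
- by rewrite F2_lift_v.
Qed.

Lemma act_a_bij : bijective act_a_fun.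
Proof.
rewrite /act_a_fun; exists (F2_lift F2_u (F2_u * F2_v)); apply: F2_endoK;
  by rewrite ?gmulfM ?gmulfV /= ?F2_lift_u ?F2_lift_v ?mulKg ?mulVKg.
Qed.

Lemma act_b_bij : bijective act_b_fun.
Proof.
rewrite /act_b_fun; exists (F2_lift (F2_v^-1 * F2_u) F2_v); apply: F2_endoK;
  by rewrite ?gmulfM ?gmulfV /= ?F2_lift_u ?F2_lift_v ?mulKg ?mulVKg.
Qed.

Definition act_a : AutGroup F2 := @MkAut F2 act_a_fun (@F2_liftM F2 _ _) act_a_bij.
Definition act_b : AutGroup F2 := @MkAut F2 act_b_fun (@F2_liftM F2 _ _) act_b_bij.

Lemma act_a_u : act_a F2_u = F2_u. Proof. exact: F2_lift_u. Qed.
Lemma act_a_v : act_a F2_v = F2_u^-1 * F2_v. Proof. exact: F2_lift_v. Qed.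
Lemma act_b_u : act_b F2_u = F2_v * F2_u. Proof. exact: F2_lift_u. Qed.
Lemma act_b_v : act_b F2_v = F2_v. Proof. exact: F2_lift_v. Qed.

Lemma act_braid : act_a * act_b * act_a = act_b * act_a * act_b.
Proof.
have autV (f : AutGroup F2) x : f x^-1 = (f x)^-1 by exact: gmulfV.
pose actE := (act_a_u, act_a_v, act_b_u, act_b_v, aut_morph, autV).
apply/autP/F2_morph_eq; [exact: aut_morph | exact: aut_morph | |].
all: rewrite !aut_mulE !actE.
all: by rewrite ?invgM ?mulgA ?mulgVK ?mulgK ?mulVg ?mul1g.
Qed.

Lemma act_rel w1 w2 : braid_rel w1 w2 ->
  word_eval (F2_gens act_a act_b) w1 = word_eval (F2_gens act_a act_b) w2.
Proof.
case=> -> ->; rewrite /word_eval !big_cons !big_nil /=.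
by rewrite /F2_gens /= !mulg1 !mulgA act_braid.
Qed.

Definition braid_action : B3 -> AutGroup F2 := plift act_rel.

HB.instance Definition _ := UMagmaMorphism.on braid_action.

Lemma braid_action_a : braid_action B3_a = act_a.
Proof. exact: plift_gen. Qed.

Lemma braid_action_b : braid_action B3_b = act_b.
Proof. exact: plift_gen. Qed.

(* The subgroup of Aut(F_2) with which B_3 is identified. *)
Definition B3_Aut : set (AutGroup F2) := range braid_action.

(* Main.v *)
Require Import Defs.
From mathcomp Require Import all_boot all_algebra zify.
From mathcomp Require Import boolp classical_sets cardinality.

Set Implicit Arguments.
Unset Strict Implicit.
Unset Printing Implicit Defensive.
Import GRing.Theory.

Local Open Scope classical_set_scope.
Local Open Scope group_scope.

(** Write H for the set of products of an inner automorphism and a braid; it is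
    a group because inner automorphisms are normal. Everything follows from two
    facts.

    The first fact is Nielsen's: every direct automorphism f is in H
    ([AutPlusE]). Among the automorphisms obtained from f by composing with an
    inner automorphism on the left and a braid on the right, take one that
    minimizes the sum of the lengths of the images of u and v. The braid
    generators and their inverses act as elementary Nielsen moves, so at the
    minimum no move shortens the basis; then cancellation in a product of images
    of letters never swallows a whole factor ([minimal_middle]), and the image
    of a reduced word with at least two letters has length at least two
    ([minimal_expands]). Hence the letters u and v are images of letters, and f
    is one of the four direct signed permutations of the basis; those are the
    powers of a quarter turn, which is s followed by an inner automorphism.
    Cancellation is measured by the longest common prefix of reduced words, which
    satisfies the ultrametric inequality of a tree. Conjugation is used to
    exclude the case where a factor is cancelled half from the left and half
    from the right; this replaces the lexicographic order of Nielsen's original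
    argument.

    The second fact is that the kernel of B_3 -> SL(2, Z) is generated by s^4
    ([rhoB_kernel]). With t = ab one has s^2 = t^3, a central element c, and
    a = t^-1 s, t s = c b^-1; therefore every braid is, up to powers of c, of the
    form s^m w t^j with w a positive word in a and b^-1 ([normal_form]). The
    matrices of a and b^-1 have nonnegative diagonal and nonpositive off-diagonal
    entries, and this sign pattern shows that such a product is scalar only when
    it is a power of c, which acts by -1 to that power.

    Since s^4 acts as conjugation by a commutator ([braid_action_s4]), an element
    of H that acts trivially on Z^2 is inner; this gives the kernel of rho^+.
    No nontrivial power of that commutator commutes with u, so the action of B_3
    is faithful. A central braid commutes with the matrices of a and b, hence
    has matrix 1 or -1, whence the index two. *)

(** * Reduced words *)

Section CommonPrefix.
Variable T : eqType.
Implicit Types s t r : seq T.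

Fixpoint lcp s t : nat :=
  match s, t with
  | x :: s', y :: t' => if x == y then (lcp s' t').+1 else 0
  | _, _ => 0
  end.

Lemma lcpC s t : lcp s t = lcp t s.
Proof. by elim: s t => [|x s IHs] [|y t] //=; rewrite eq_sym IHs. Qed.

Lemma lcp_le s t : lcp s t <= size s.
Proof. by elim: s t => [|x s IHs] [|y t] //=; case: eqP => // _; apply: IHs. Qed.

Lemma take_lcp s t n : n <= lcp s t -> take n s = take n t.
Proof.
elim: n s t => [|n IHn] s t; first by rewrite !take0.
by case: s t => [|x s] [|y t] //=; case: eqP => // -> /IHn ->.
Qed.

Lemma lcp_trans s t r : minn (lcp s t) (lcp t r) <= lcp s r.
Proof.
elim: s t r => [|x s IHs] [|y t] [|z r] //=; rewrite ?min0n ?minn0 //.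
case: (x =P y) => [->|_]; last by rewrite min0n.
by case: eqP => // _; rewrite ?minnSS ?minn0 // ltnS IHs.
Qed.

End CommonPrefix.

Section ReducedWords.
Variable X : choiceType.
Implicit Types (l m : X * bool) (w r : word X).

Definition linv l : X * bool := (l.1, ~~ l.2).

Lemma linvK : involutive linv.
Proof. by case=> x b; rewrite /linv negbK. Qed.

Lemma linv_eq l : (l == linv l) = false.
Proof. by case: l => x [] //=; rewrite /linv xpair_eqE andbF. Qed.

Lemma word_inv_cons l w : word_inv (l :: w) = rcons (word_inv w) (linv l).
Proof. by rewrite /word_inv /= rev_cons. Qed.

Lemma word_inv_rcons l w : word_inv (rcons w l) = linv l :: word_inv w.
Proof. by rewrite -{1}[w]word_invK -{1}[l]linvK -word_inv_cons word_invK. Qed.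

Lemma size_word_inv w : size (word_inv w) = size w.
Proof. by rewrite /word_inv size_rev size_map. Qed.

Definition reduced w : bool := sorted (fun l m => m != linv l) w.

(** Left multiplication by a letter, on reduced words. *)
Definition push l w : word X :=
  if w is m :: w' then if m == linv l then w' else l :: w else [:: l].

Definition act_word w r : word X := foldr push r w.

Definition red w : word X := act_word w [::].

Lemma red_cons l w : red (l :: w) = push l (red w).
Proof. by []. Qed.

Lemma reduced_push l w : reduced w -> reduced (push l w).
Proof.
case: w => [|m w] //= rw; case: ifP => [_|/negbT ml]; first exact: path_sorted rw.
by rewrite /reduced /= ml.
Qed.

Lemma reduced_act w r : reduced r -> reduced (act_word w r).
Proof. by move=> rr; elim: w => //= l w; apply: reduced_push. Qed.

Lemma pushK l w : reduced w -> push (linv l) (push l w) = w.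
Proof.
case: w => [|m w] rw /=; first by rewrite linvK eqxx.
case: ifP => [/eqP ml|_] /=; last by rewrite linvK eqxx.
case: w rw => [|n w] /=; rewrite -ml // => /andP[nm _].
by rewrite (negbTE nm).
Qed.

Lemma act_word_cat w1 w2 r : act_word (w1 ++ w2) r = act_word w1 (act_word w2 r).
Proof. by rewrite /act_word foldr_cat. Qed.

(** By [pushK], opposite letters act on reduced words by inverse permutations.
    Words therefore act through the free group, which makes the reduced form
    of a word an invariant of its class. *)
Lemma act_word_eq w1 w2 :
  word_eq (fun _ _ : word X => False) w1 w2 ->
  forall r, reduced r -> act_word w1 r = act_word w2 r.
Proof.
elim=> // {w1 w2}.
- by move=> w1 w2 _ IH r rr; rewrite IH.
- by move=> w1 w2 w3 _ IH1 _ IH2 r rr; rewrite IH1 // IH2.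
- move=> w1 w2 w1' w2' _ IH1 _ IH2 r rr.
  by rewrite !act_word_cat IH2 // IH1 //; apply: reduced_act.
- move=> x b r rr.
  by rewrite -[act_word _ r]/(push (x, b) (push (x, ~~ b) r))
             -[(x, b)]linvK pushK.
Qed.

Lemma red_reduced w : reduced w -> red w = w.
Proof.
elim: w => [|l w IHw] // rw.
have rw' : reduced w := path_sorted rw.
rewrite red_cons IHw //.
by case: w rw {IHw rw'} => [|m w] //= /andP[/negbTE ->].
Qed.

Lemma word_eq_red w : word_eq (fun _ _ : word X => False) (red w) w.
Proof.
elim: w => [|l w IHw]; first exact: WordRefl.
have e1 : word_eq (fun _ _ : word X => False) (l :: red w) (l :: w).
  exact: (WordCat (WordRefl _ [:: l]) IHw).
apply: (WordTrans _ e1); rewrite red_cons.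
case: (red w) => [|m r] /=; first exact: WordRefl.
case: ifP => [/eqP ->|_]; last exact: WordRefl.
apply: WordSym; rewrite -[X in word_eq _ _ X]cat0s -(cat1s l) -(cat1s (linv l)) catA.
apply: WordCat; last exact: WordRefl.
by case: l {e1} => x b; apply: WordCancel.
Qed.

Lemma size_red w : size (red w) <= size w.
Proof.
elim: w => [|l w IHw] //; rewrite red_cons.
by case: (red w) IHw => [|m r] //=; case: ifP => //= _; lia.
Qed.

Lemma reduced_inv w : reduced (word_inv w) = reduced w.
Proof.
rewrite /reduced /word_inv rev_sorted sorted_map.
apply: (@eq_sorted _ _ (fun l m => m != linv l)) => -[x b] [y c] /=.
by rewrite /linv /= !xpair_eqE /= [x == y]eq_sym; case: b; case: c.
Qed.

Lemma reduced_cat w1 l w2 :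
  reduced (w1 ++ l :: w2) = reduced (rcons w1 l) && reduced (l :: w2).
Proof. by rewrite /reduced; case: w1 => //= m w1; rewrite cat_path rcons_path andbA. Qed.

(** Beyond their common prefix, two reduced words diverge, so that nothing
    cancels between the inverse of the first tail and the second tail. *)
Lemma reduced_diverge w1 w2 : reduced w1 -> reduced w2 ->
  reduced (word_inv (drop (lcp w1 w2) w1) ++ drop (lcp w1 w2) w2).
Proof.
elim: w1 w2 => [|l w1 IHw] [|m w2] r1 r2 //=.
- by rewrite cats0 reduced_inv.
case: eqP => [_|/eqP lm] /=; first by apply: IHw; [exact: path_sorted r1|exact: path_sorted r2].
rewrite reduced_cat r2 andbT -[X in reduced X]word_invK reduced_inv.
rewrite word_inv_rcons word_invK /reduced /= linvK lm.
by [].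
Qed.

(** A reduced word w that agrees with its own inverse on half its length
    would have a letter equal to its inverse in the middle, or two adjacent
    inverse letters. *)
Lemma lcp_inv_lt w : reduced w -> 0 < size w -> (lcp (word_inv w) w).*2 < size w.
Proof.
move=> rw w0; rewrite ltnNge; apply/negP => le.
have [[x0 b0] _] : exists l : X * bool, true by case: w w0 {rw le} => // l; exists l.
set x := (x0, b0).
(* For odd length k is the middle position, for even length the left middle one. *)
pose k := (size w).-1./2.
have kl : k < lcp (word_inv w) w by rewrite /k; lia.
have ks : k < size w by rewrite /k; lia.
have := take_lcp kl => /(congr1 (fun s => nth x s k)).
rewrite !nth_take // /word_inv nth_rev ?size_map //.
rewrite (nth_map x); last by rewrite /k; lia.
rewrite -/(linv _) => e.
case: (boolP (odd (size w))) => od.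
  move: e; have -> : size w - k.+1 = k by rewrite /k; lia.
  by move/esym/eqP; rewrite linv_eq.
move: e; have -> : size w - k.+1 = k.+1 by rewrite /k; lia.
move=> e; have ks1 : k.+1 < size w by rewrite /k; lia.
by have := elimT (sortedP x) rw k ks1; rewrite -e linvK eqxx.
Qed.

End ReducedWords.

(** * Word length on F_2 *)

Implicit Types g h : F2.

Definition F2_word (w : word 'I_2) : F2 := class_of (fun _ _ : word 'I_2 => False) w.

Definition nf (g : F2) : word 'I_2 := red (repr g).

Definition len (g : F2) : nat := size (nf g).

(** In the Cayley tree this is the Gromov product of g and h at 1, and
    [cpl g^-1 h] is the number of letters of g that cancel in g * h. *)
Definition cpl (g h : F2) : nat := lcp (nf g) (nf h).

Lemma F2_word_cat w1 w2 : F2_word (w1 ++ w2) = F2_word w1 * F2_word w2.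
Proof. by rewrite [RHS]class_ofM. Qed.

Lemma F2_wordV w : F2_word (word_inv w) = (F2_word w)^-1.
Proof. by rewrite [RHS]pinvE. Qed.

Lemma F2_word_repr (g : F2) : F2_word (repr g) = g.
Proof. exact: class_of_repr. Qed.

Lemma nfK : cancel nf F2_word.
Proof. by move=> g; rewrite -[RHS]F2_word_repr; apply/class_ofP/word_eq_red. Qed.

Lemma nf_reduced g : reduced (nf g).
Proof. exact: reduced_act. Qed.

Lemma nf_F2_word w : nf (F2_word w) = red w.
Proof. by apply: act_word_eq => //; apply: word_eq_repr. Qed.

Lemma nf_F2_word_reduced w : reduced w -> nf (F2_word w) = w.
Proof. by move=> rw; rewrite nf_F2_word red_reduced. Qed.

Lemma nfV g : nf g^-1 = word_inv (nf g).
Proof. by rewrite -{1}[g]nfK -F2_wordV nf_F2_word_reduced // reduced_inv nf_reduced. Qed.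

Lemma nf1 : nf 1 = [::].
Proof. exact: (nf_F2_word [::]). Qed.

Lemma lenV g : len g^-1 = len g.
Proof. by rewrite /len nfV size_word_inv. Qed.

Lemma len_F2_word w : len (F2_word w) <= size w.
Proof. by rewrite /len nf_F2_word size_red. Qed.

Lemma len_gt0 g : (0 < len g) = (g != 1).
Proof.
apply/idP/idP => [|/eqP g1]; first by apply: contraTneq => ->; rewrite /len nf1.
by rewrite lt0n; apply/negP => /nilP e; case: g1; rewrite -[g]nfK e.
Qed.

Lemma cplC g h : cpl g h = cpl h g.
Proof. exact: lcpC. Qed.

Lemma cpl_trans g h (k : F2) : minn (cpl g h) (cpl h k) <= cpl g k.
Proof. exact: lcp_trans. Qed.

Lemma cpl_le g h : cpl g h <= len g.
Proof. exact: lcp_le. Qed.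

Lemma len_divl g h : len (g^-1 * h) + (cpl g h).*2 = len g + len h.
Proof.
set n := cpl g h; set w1 := drop n (nf g); set w2 := drop n (nf h).
have et : take n (nf g) = take n (nf h) by apply: take_lcp.
have -> : g^-1 * h = F2_word (word_inv w1 ++ w2).
  rewrite F2_word_cat F2_wordV -{1}[g]nfK -{1}[h]nfK.
  rewrite -{1}(cat_take_drop n (nf g)) -{1}(cat_take_drop n (nf h)) -/w1 -/w2 et.
  by rewrite !F2_word_cat invgM -mulgA mulKg.
rewrite /len nf_F2_word_reduced; last by apply: reduced_diverge; apply: nf_reduced.
rewrite size_cat size_word_inv !size_drop.
have := cpl_le g h; have := cpl_le h g; rewrite cplC /len -/n; lia.
Qed.

Lemma len_mul g h : len (g * h) + (cpl g^-1 h).*2 = len g + len h.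
Proof. by have := len_divl g^-1 h; rewrite invgK lenV. Qed.

(** By [len_mul], this says that g * g is longer than g. *)
Lemma cpl_inv_lt g : g != 1 -> (cpl g^-1 g).*2 < len g.
Proof.
rewrite -len_gt0 => g1; rewrite /cpl nfV; apply: lcp_inv_lt => //.
exact: nf_reduced.
Qed.

Definition letter (l : 'I_2 * bool) : F2 := F2_word [:: l].

Lemma letterV l : letter (linv l) = (letter l)^-1.
Proof. by rewrite -F2_wordV. Qed.

Lemma F2_word_cons l w : F2_word (l :: w) = letter l * F2_word w.
Proof. by rewrite -F2_word_cat. Qed.

Lemma nf_letter l : nf (letter l) = [:: l].
Proof. exact: nf_F2_word_reduced. Qed.

Lemma letter_u : letter (ord0, true) = F2_u. Proof. by []. Qed.
Lemma letter_v : letter (ord_max, true) = F2_v. Proof. by []. Qed.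
Lemma letter_uV : letter (ord0, false) = F2_u^-1. Proof. exact: (letterV (ord0, true)). Qed.
Lemma letter_vV : letter (ord_max, false) = F2_v^-1. Proof. exact: (letterV (ord_max, true)). Qed.

Definition letterE := (letter_u, letter_v, letter_uV, letter_vV).

Variant letter_spec : 'I_2 * bool -> Prop :=
| LetterU b : letter_spec (ord0, b)
| LetterV b : letter_spec (ord_max, b).

Lemma letterP l : letter_spec l.
Proof. by case: l => i b; case: (ord2P i) => ->; constructor. Qed.

(** * Automorphisms that minimize the length of a basis *)

Lemma autV (f : AutGroup F2) x : f x^-1 = (f x)^-1.
Proof. exact: gmulfV. Qed.

Lemma aut_inj (f : AutGroup F2) : injective f.
Proof. exact: bij_inj (aut_bij f). Qed.

Lemma act_aV_u : act_a^-1 F2_u = F2_u.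
Proof. by apply: (@aut_inj act_a); rewrite -aut_mulE mulgV act_a_u. Qed.

Lemma act_aV_v : act_a^-1 F2_v = F2_u * F2_v.
Proof.
apply: (@aut_inj act_a).
by rewrite -aut_mulE mulgV aut_morph act_a_u act_a_v mulVKg.
Qed.

Lemma act_bV_u : act_b^-1 F2_u = F2_v^-1 * F2_u.
Proof.
apply: (@aut_inj act_b).
by rewrite -aut_mulE mulgV aut_morph autV act_b_u act_b_v mulKg.
Qed.

Lemma act_bV_v : act_b^-1 F2_v = F2_v.
Proof. by apply: (@aut_inj act_b); rewrite -aut_mulE mulgV act_b_v. Qed.

Definition actE := (act_a_u, act_a_v, act_b_u, act_b_v,
  act_aV_u, act_aV_v, act_bV_u, act_bV_v, autV, aut_morph).

Lemma braid_action_aV : braid_action B3_a^-1 = act_a^-1.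
Proof. by rewrite gmulfV /= braid_action_a. Qed.

Lemma braid_action_bV : braid_action B3_b^-1 = act_b^-1.
Proof. by rewrite gmulfV /= braid_action_b. Qed.

(** The generators a, b and their inverses multiply one basis element by the
    other or its inverse, on the left. If m is the inverse of a generator, this
    gives m |-> m l, and conjugating by l^-1 gives m |-> l m with l unchanged. *)
Lemma transvection l m : l.1 != m.1 ->
  exists (x : B3) (g : F2), (braid_action x (letter l)) ^ g = letter l /\
    (braid_action x (letter m)) ^ g = letter l * letter m.
Proof.
pose baE := (braid_action_a, braid_action_b, braid_action_aV, braid_action_bV).
case: (letterP l) => b; case: (letterP m) => c //= _.
- exists (if b == c then B3_a^-1 else B3_a).
  exists (if c then 1 else (letter (ord0, b))^-1).
  by case: b; case: c; rewrite !baE !letterE !actE !conjgE ?invg1 ?invgM ?invgK;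
     rewrite ?mul1g ?mulg1 ?mulgA ?mulgVK ?mulgK ?mulgV ?mulVg ?mul1g.
- exists (if b == c then B3_b else B3_b^-1).
  exists (if c then 1 else (letter (ord_max, b))^-1).
  by case: b; case: c; rewrite !baE !letterE !actE !conjgE ?invg1 ?invgM ?invgK;
     rewrite ?mul1g ?mulg1 ?mulgA ?mulgVK ?mulgK ?mulgV ?mulVg ?mul1g.
Qed.

(** Allowing inner automorphisms besides the braids is what makes a minimal
    basis free of half cancellations on both sides; see [half_cancel]. *)
Definition nielsen_minimal (f : AutGroup F2) : Prop :=
  forall (g : F2) (x : B3), let f' : AutGroup F2 := inner g * f * braid_action x in
    len (f F2_u) + len (f F2_v) <= len (f' F2_u) + len (f' F2_v).

Lemma len_letters (f : AutGroup F2) l m : l.1 != m.1 ->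
  len (f (letter l)) + len (f (letter m)) = len (f F2_u) + len (f F2_v).
Proof.
by case: (letterP l) => -[]; case: (letterP m) => -[] //= _;
  rewrite !letterE ?autV ?lenV // addnC.
Qed.

(** If q = h e^-1 with h and e of length k, and z = e w h^-1, then q cancels
    half against each of two copies of z. Conjugating q and q * z by h gives
    e^-1 h and w, which is a shorter pair. *)
Lemma half_cancel (q z : F2) k :
    k <= cpl z^-1 q -> k <= cpl q^-1 z -> len q = k.*2 -> k.*2 <= len z ->
  exists g : F2, len (q ^ g) <= len q /\ len ((q * z) ^ g) + len q <= len z.
Proof.
move=> kzq kqz lq lz; pose h := take k (nf q); pose e := take k (nf z).
have sh : size h = k by rewrite size_takel // -/(len q); lia.
have se : size e = k by rewrite size_takel // -/(len z); lia.
have nq : nf q = h ++ word_inv e.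
  rewrite -{1}[nf q]word_invK -nfV -(cat_take_drop k (nf q^-1)) (take_lcp kqz) -/e.
  rewrite word_inv_cat; set r := word_inv (drop _ _).
  have sr : size r = k.
    by rewrite /r size_word_inv size_drop -/(len _) lenV lq; lia.
  congr (_ ++ _); rewrite /h -[nf q]word_invK -nfV.
  by rewrite -(cat_take_drop k (nf q^-1)) (take_lcp kqz) word_inv_cat take_size_cat.
have [w zE sw] : exists2 w, nf z = e ++ w ++ word_inv h & size w + k.*2 = len z.
  pose r := word_inv (drop k (nf z^-1)).
  have sr : size r + k = len z.
    by rewrite /r size_word_inv size_drop -/(len _) lenV; lia.
  have zr : nf z = r ++ word_inv h.
    rewrite -[LHS]word_invK -nfV -(cat_take_drop k (nf z^-1)) word_inv_cat.
    by rewrite (take_lcp kzq).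
  (* e and h do not overlap in z, because k.*2 <= len z. *)
  exists (drop k r); last by rewrite size_drop; lia.
  have -> : e = take k r by rewrite /e zr takel_cat //; lia.
  by rewrite catA cat_take_drop.
have qE : q = F2_word h * (F2_word e)^-1 by rewrite -[q]nfK nq F2_word_cat F2_wordV.
have {}zE : z = F2_word e * (F2_word w * (F2_word h)^-1).
  by rewrite -[z]nfK zE !F2_word_cat F2_wordV.
exists (F2_word h); rewrite !conjgE lq; split.
  rewrite qE -mulgA mulKg -F2_wordV -F2_word_cat; apply: leq_trans (len_F2_word _) _.
  by rewrite size_cat size_word_inv sh se addnn.
rewrite -sw leq_add2r qE zE !mulgA mulVg mul1g !mulgVK mulVg mul1g.
exact: len_F2_word.
Qed.

Section Minimal.
Variable f : AutGroup F2.
Hypothesis min_f : nielsen_minimal f.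

Let F l : F2 := f (letter l).

Let FV l : F (linv l) = (F l)^-1.
Proof. by rewrite /F letterV autV. Qed.

Let F_neq1 l : F l != 1.
Proof.
apply/eqP => /(congr1 (f^-1 : AutGroup F2)); rewrite -aut_mulE mulVg aut1.
by move/(congr1 nf); rewrite nf1 nf_letter.
Qed.

Lemma minimal_transvection l m (g : F2) : l.1 != m.1 ->
  len (F l) + len (F m) <= len (F l ^ g) + len ((F l * F m) ^ g).
Proof.
move=> lm; have [x [h [el em]]] := transvection lm.
rewrite (len_letters f lm).
apply: leq_trans (min_f (f h * g) x) _.
rewrite -(len_letters _ lm) !aut_mulE /= !conjgM.
have fJ y : f y ^ f h = f (y ^ h) by rewrite !conjgE !aut_morph autV.
by rewrite !fJ el em aut_morph.
Qed.

(** More cancellation would make the product shorter than one of its factors,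
    so that a transvection would shorten the basis. *)
Lemma minimal_cancel l m : l.1 != m.1 ->
  (cpl (F l)^-1 (F m)).*2 <= len (F l) /\ (cpl (F l)^-1 (F m)).*2 <= len (F m).
Proof.
move=> lm; split.
  have := minimal_transvection 1 lm; rewrite !conjg1.
  by have := len_mul (F l) (F m); lia.
have ml : (linv m).1 != (linv l).1 by rewrite eq_sym.
have := minimal_transvection 1 ml; rewrite !conjg1 !FV.
by have := len_mul (F m)^-1 (F l)^-1; rewrite invgK cplC !lenV; lia.
Qed.

Lemma linv_neq_same (l m : 'I_2 * bool) : m != linv l -> l.1 = m.1 -> m = l.
Proof.
by case: l m => [x b] [y c] /= + xy; rewrite /linv /= xy xpair_eqE eqxx; case: b; case: c.
Qed.

Lemma minimal_cancel_reduced l m : m != linv l ->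
  (cpl (F l)^-1 (F m)).*2 <= len (F l) /\ (cpl (F l)^-1 (F m)).*2 <= len (F m).
Proof.
move=> ml; case: (eqVneq l.1 m.1) => [|lm]; last exact: minimal_cancel.
by move/(linv_neq_same ml) => ->; split; apply: ltnW; apply: cpl_inv_lt (F_neq1 l).
Qed.

(** Each side cancels at most half of the middle factor, and strictly less when
    its letter is the middle one. If both sides cancel exactly half, the outer
    letters are inverse or equal: inverse letters would make the middle factor
    cancel half against itself, by the ultrametric inequality, and equal letters
    contradict minimality by [half_cancel]. *)
Lemma minimal_middle l m n : m != linv l -> n != linv m ->
  cpl (F l)^-1 (F m) + cpl (F m)^-1 (F n) < len (F m).
Proof.
move=> ml nm.
have [k1' k1] := minimal_cancel_reduced ml; have [k2 _] := minimal_cancel_reduced nm.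
have sq := cpl_inv_lt (F_neq1 m).
case: (eqVneq l.1 m.1) => [/(linv_neq_same ml) e|lm]; first by move: k1 k2 sq; rewrite e; lia.
case: (eqVneq m.1 n.1) => [/(linv_neq_same nm) e|mn]; first by move: k1 k2 sq; rewrite e; lia.
rewrite ltnNge; apply/negP => le.
set k := cpl (F l)^-1 (F m) in k1 k1' le.
have k2E : cpl (F m)^-1 (F n) = k by lia.
have lq : len (F m) = k.*2 by lia.
have : n = l \/ n = linv l.
  move: lm mn; case: (letterP l) => b; case: (letterP m) => c; case: (letterP n) => d //= _ _;
  by case: b; case: d; rewrite /linv /=; auto.
case=> e; rewrite e in k2E.
  have [||||g [gq gz]] := @half_cancel (F m) (F l) k => //; rewrite ?k2E //.
  have ml1 : m.1 != l.1 by rewrite eq_sym.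
  have := minimal_transvection g ml1; have : 0 < len (F m) by rewrite len_gt0.
  by move: gq gz; rewrite -/k; lia.
have := cpl_trans (F m)^-1 (F l)^-1 (F m).
by rewrite -/k -(FV l) k2E minnn; lia.
Qed.

(** By induction on the word: the first factor cancels against the rest exactly
    as it does against the second factor alone, because by [minimal_middle] the
    part of the second factor that survives on its right is longer than what
    cancels on its left. The first two clauses carry the induction. *)
Lemma minimal_expands l w : reduced (l :: w) ->
  [/\ cpl (F l) (f (F2_word (l :: w))) >= len (F l) -
        (if w is m :: _ then cpl (F l)^-1 (F m) else 0),
      len (F l) <= len (f (F2_word (l :: w))) &
      w != [::] -> 1 < len (f (F2_word (l :: w)))].
Proof.
elim: w l => [|m w IHw] l.
  move=> _; rewrite -/(F l); split=> //.
  by rewrite /cpl subn0; have -> : forall w : word 'I_2, lcp w w = size w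
    by elim=> //= x w ->; rewrite eqxx.
move=> rw; have ml : m != linv l by case/andP: rw.
have rw' : reduced (m :: w) := path_sorted rw.
have [IH1 IH2 IH3] := IHw m rw'.
rewrite F2_word_cons aut_morph -/(F l); set G := f _ in IH1 IH2 IH3 *.
set k := cpl (F l)^-1 (F m).
have [k1 k2] := minimal_cancel_reduced ml; rewrite -/k in k1 k2.
(* By the ultrametric inequality, as k < cpl (F m) G *)
have kG : cpl (F l)^-1 G = k.
  have lt_k : k < cpl (F m) G.
    apply: leq_trans IH1.
    case: (w) rw' => [|n w'] rw'; last first.
      have nm : n != linv m by case/andP: rw'.
      by have := minimal_middle ml nm; rewrite -/k; lia.
    by move: (F_neq1 m); rewrite -len_gt0; lia.
  have := cpl_trans (F l)^-1 (F m) G; have := cpl_trans (F l)^-1 G (F m).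
  by rewrite (cplC G) -/k; lia.
have lG := len_mul (F l) G; rewrite kG in lG.
have lFl : 0 < len (F l) by rewrite len_gt0.
have lFm : 0 < len (F m) by rewrite len_gt0.
have cG : cpl (F l) (F l * G) = len (F l) - k.
  have := len_divl (F l) (F l * G); rewrite mulKg; have := cpl_le (F l)^-1 (F m).
  by rewrite lenV -/k; lia.
by split; [rewrite cG | lia | lia].
Qed.

End Minimal.

(** * Inner automorphisms, braids and matrices *)

Lemma innerM (g h : F2) : inner g * inner h = inner (h * g).
Proof. by apply: autP => x; rewrite aut_mulE /= conjgM. Qed.

Lemma inner1 : inner (1 : F2) = 1.
Proof. by apply: autP => x; rewrite /= conjg1. Qed.

Lemma innerV (g : F2) : (inner g)^-1 = inner g^-1.
Proof. by apply: (mulgI (inner g)); rewrite mulgV innerM mulVg inner1. Qed.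

Lemma aut_inner (f : AutGroup F2) (g : F2) : f * inner g = inner (f g) * f.
Proof. by apply: autP => x; rewrite !aut_mulE /= !conjgE !aut_morph autV. Qed.

Lemma IntAut_subgroup : is_subgroup (IntAut F2).
Proof.
split; first by exists 1 => //; exact: inner1.
- by move=> _ _ [g _ <-] [h _ <-]; exists (h * g) => //; rewrite innerM.
- by move=> _ [g _ <-]; exists g^-1 => //; rewrite innerV.
Qed.

Lemma B3_Aut_subgroup : is_subgroup B3_Aut.
Proof.
split; first by exists 1 => //; exact: gmulf1.
- by move=> _ _ [x _ <-] [y _ <-]; exists (x * y) => //; rewrite gmulfM.
- by move=> _ [x _ <-]; exists x^-1 => //; rewrite gmulfV.
Qed.

Lemma IntB3P (f : AutGroup F2) :
  mulset (IntAut F2) B3_Aut f <-> exists g x, f = inner g * braid_action x.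
Proof.
split; first by move=> [_ [g _ <-]] [_ [x _ <-]] <-; exists g, x.
move=> [g [x ->]]; exists (inner g); first by exists g.
by exists (braid_action x) => //; exists x.
Qed.

Lemma IntB3_subgroup : is_subgroup (mulset (IntAut F2) B3_Aut).
Proof.
split.
- by apply/IntB3P; exists 1, 1; rewrite inner1 gmulf1 mulg1.
- move=> _ _ /IntB3P[g [x ->]] /IntB3P[h [y ->]]; apply/IntB3P.
  exists (braid_action x h * g), (x * y).
  by rewrite gmulfM -innerM -!mulgA; congr (_ * _); rewrite !mulgA aut_inner.
- move=> _ /IntB3P[g [x ->]]; apply/IntB3P.
  exists (braid_action x^-1 g^-1), x^-1.
  by rewrite invgM innerV -gmulfV aut_inner.
Qed.

Lemma abel1 : abel 1 = 0%R.
Proof. by apply: (@addrI _ (abel 1)); rewrite -abelM mulg1 addr0. Qed.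

Lemma abelV x : abel x^-1 = (- abel x)%R.
Proof. by apply: (@addrI _ (abel x)); rewrite -abelM mulgV abel1 subrr. Qed.

Lemma rho_inner (g : F2) : rho (inner g) = 1%:M%R.
Proof.
rewrite -rho1; apply/matrixP => i j; rewrite !mxE /= conjgE !abelM abelV.
by rewrite addrCA addNr addr0.
Qed.

Definition mx2 (p q r w : int) : 'M[int]_2 :=
  \matrix_(i, j) if i == ord0 then if j == ord0 then p else q
                 else if j == ord0 then r else w.

Lemma mx2_eta (A : 'M[int]_2) :
  A = mx2 (A ord0 ord0) (A ord0 ord_max) (A ord_max ord0) (A ord_max ord_max).
Proof.
by apply/matrixP => i j; rewrite mxE; case: (ord2P i) => ->; case: (ord2P j) => ->.
Qed.

Lemma mx2_inj p q r w p' q' r' w' :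
  mx2 p q r w = mx2 p' q' r' w' -> [/\ p = p', q = q', r = r' & w = w'].
Proof.
move=> /matrixP e; split; [have := e ord0 ord0 | have := e ord0 ord_max
  | have := e ord_max ord0 | have := e ord_max ord_max]; by rewrite !mxE.
Qed.

Lemma mx2M p q r w p' q' r' w' : (mx2 p q r w *m mx2 p' q' r' w')%R =
  mx2 (p * p' + q * r') (p * q' + q * w') (r * p' + w * r') (r * q' + w * w').
Proof.
apply/matrixP => i j; rewrite !mxE big_ord_recl big_ord1 !mxE /=.
by case: (ord2P i) => ->; case: (ord2P j) => ->.
Qed.

Lemma det_mx2 p q r w : (\det (mx2 p q r w) = p * w - q * r)%R.
Proof.
rewrite (expand_det_row _ ord0) !big_ord_recl big_ord0 /cofactor !det_mx11 !mxE /=.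
by rewrite addr0 !mul1r mulN1r mulrN.
Qed.

Lemma mx2_scalar c : (c%:M)%R = mx2 c 0 0 c.
Proof. by rewrite [LHS]mx2_eta !mxE. Qed.

Lemma rho_mx2 (f : AutGroup F2) p q r w :
  abel (f F2_u) = (p *: delta_mx ord0 0 + r *: delta_mx ord_max 0)%R ->
  abel (f F2_v) = (q *: delta_mx ord0 0 + w *: delta_mx ord_max 0)%R ->
  rho f = mx2 p q r w.
Proof.
move=> eu ev; rewrite [LHS]mx2_eta !mxE -/F2_u -/F2_v eu ev !mxE /=.
by rewrite !mulr1 !mulr0 !addr0 !add0r.
Qed.

Lemma rho_a : rho (braid_action B3_a) = mx2 1 (-1) 0 1.
Proof.
rewrite braid_action_a; apply: rho_mx2; rewrite !actE ?abelM ?abelV !abel_gen.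
  by rewrite scale1r scale0r addr0.
by rewrite scaleN1r scale1r.
Qed.

Lemma rho_b : rho (braid_action B3_b) = mx2 1 0 1 1.
Proof.
rewrite braid_action_b; apply: rho_mx2; rewrite !actE ?abelM ?abelV !abel_gen.
  by rewrite !scale1r addrC.
by rewrite scale1r scale0r add0r.
Qed.

Lemma AutPlus_subgroup : is_subgroup AutPlus.
Proof.
split; first by rewrite /AutPlus /SL2Z /= rho1 det1.
- by move=> f g; rewrite /AutPlus /SL2Z /= rhoM det_mulmx => -> ->; rewrite mulr1.
- move=> f; rewrite /AutPlus /SL2Z /= => df.
  by have := congr1 determinant (rhoM f f^-1); rewrite mulgV rho1 det1 det_mulmx df mul1r.
Qed.

Lemma B3_ind (P : B3 -> Prop) : P 1 ->
  (forall x, P x -> P (B3_a * x)) -> (forall x, P x -> P (B3_a^-1 * x)) ->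
  (forall x, P x -> P (B3_b * x)) -> (forall x, P x -> P (B3_b^-1 * x)) ->
  forall x, P x.
Proof.
move=> P1 Pa PaV Pb PbV x; rewrite -[x]class_of_repr.
elim: (repr x) => [|[i c] w IHw]; first exact: P1.
have -> : class_of braid_rel ((i, c) :: w) =
    (if c then pgen braid_rel i else (pgen braid_rel i)^-1) * class_of braid_rel w.
  case: c; first by rewrite [RHS]class_ofM.
  by rewrite [X in X * _]pinvE [RHS]class_ofM.
by case: c; case: (ord2P i) => ->; [apply: Pa|apply: Pb|apply: PaV|apply: PbV].
Qed.

Lemma B3_Aut_AutPlus : B3_Aut `<=` AutPlus.
Proof.
have [p1 pM pV] := AutPlus_subgroup.
have pa : AutPlus (braid_action B3_a) by rewrite /AutPlus /SL2Z /= rho_a det_mx2.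
have pb : AutPlus (braid_action B3_b) by rewrite /AutPlus /SL2Z /= rho_b det_mx2.
move=> _ [x _ <-]; elim/B3_ind: x => [|x Px|x Px|x Px|x Px]; rewrite ?gmulfM ?gmulfV ?gmulf1 //;
  by apply: pM => //; apply: pV.
Qed.

Lemma IntAut_AutPlus : IntAut F2 `<=` AutPlus.
Proof. by move=> _ [g _ <-]; rewrite /AutPlus /SL2Z /= rho_inner det1. Qed.

Definition quarter_turn : AutGroup F2 := inner F2_u^-1 * braid_action B3_s.

Lemma braid_action_s : braid_action B3_s = act_a * act_b * act_a.
Proof. by rewrite !gmulfM /= braid_action_a braid_action_b. Qed.

Lemma act_s_u : braid_action B3_s F2_u = F2_u^-1 * F2_v * F2_u.
Proof. by rewrite braid_action_s !aut_mulE !actE. Qed.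

Lemma act_s_v : braid_action B3_s F2_v = F2_u^-1.
Proof. by rewrite braid_action_s !aut_mulE !actE invgM mulgVK. Qed.

Lemma quarter_turn_u : quarter_turn F2_u = F2_v.
Proof.
by rewrite aut_mulE act_s_u /= conjgE invgK !mulgA mulgV mul1g mulgK.
Qed.

Lemma quarter_turn_v : quarter_turn F2_v = F2_u^-1.
Proof. by rewrite aut_mulE act_s_v /= conjgE invgK mulVKg. Qed.

Lemma IntB3_quarter_turn : mulset (IntAut F2) B3_Aut quarter_turn.
Proof. by apply/IntB3P; exists F2_u^-1, B3_s. Qed.

(** Of the sixteen pairs of letters, the determinant leaves the four pairs that
    are the powers of the quarter turn. *)
Lemma signed_permutation_IntB3 (f : AutGroup F2) l m :
  f F2_u = letter l -> f F2_v = letter m -> AutPlus f -> mulset (IntAut F2) B3_Aut f.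
Proof.
have [H1 HM HV] := IntB3_subgroup; have Hq := IntB3_quarter_turn.
have qV x : quarter_turn x^-1 = (quarter_turn x)^-1 by exact: autV.
pose qE := (quarter_turn_u, quarter_turn_v, qV, invgK).
have det p q r w : rho f = mx2 p q r w -> AutPlus f -> (p * w - q * r = 1)%R.
  by rewrite /AutPlus /SL2Z /= => ->; rewrite det_mx2.
(* c l i is the i-th coordinate of the letter l in Z^2. *)
pose c (l : 'I_2 * bool) i : int := (if l.1 == i then (if l.2 then 1 else -1) else 0)%R.
have lc k : abel (letter k) = (c k ord0 *: delta_mx ord0 0 + c k ord_max *: delta_mx ord_max 0)%R.
  by case: (letterP k) => -[]; rewrite !letterE /c /= ?abelV !abel_gen;
    rewrite ?scale0r ?addr0 ?add0r ?scale1r ?scaleN1r.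
move=> fu fv /(det (c l ord0) (c m ord0) (c l ord_max) (c m ord_max)) => H.
have {}H : (c l ord0 * c m ord_max - c m ord0 * c l ord_max = 1)%R.
  by apply: H; apply: rho_mx2; rewrite ?fu ?fv lc.
suff: exists2 h, mulset (IntAut F2) B3_Aut h & h F2_u = letter l /\ h F2_v = letter m.
  move=> [h Hh [hu hv]]; have -> // : f = h.
  by apply/autP/F2_morph_eq; [exact: aut_morph|exact: aut_morph|rewrite fu hu|rewrite fv hv].
move: H; rewrite /c {fu fv lc c det}.
case: (letterP l) => -[]; case: (letterP m) => -[] //= _.
- by exists 1.
- exists (quarter_turn * quarter_turn); first exact: (HM _ _ Hq Hq).
  by rewrite !(aut_mulE quarter_turn) !qE !letterE.
- by exists quarter_turn; rewrite ?qE ?letterE.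
- exists (quarter_turn * (quarter_turn * quarter_turn)); first exact: (HM _ _ Hq (HM _ _ Hq Hq)).
  by rewrite !(aut_mulE quarter_turn) !qE !letterE.
Qed.

(** The element that a minimal f maps to a letter cannot be a reduced word of
    length two or more, since the letter has length one. *)
Lemma minimal_onto_letters f l : nielsen_minimal f -> exists m, f^-1 (letter l) = letter m.
Proof.
move=> min_f; have fE : f (f^-1 (letter l)) = letter l by rewrite -aut_mulE mulgV.
have r := nf_reduced (f^-1 (letter l)).
move: fE; rewrite -[f^-1 (letter l)]nfK.
case: (nf _) r => [|m [|n w]] r; last 2 first.
- by exists m.
- have [_ _ /(_ isT) lt1] := minimal_expands min_f r => fE.
  by move: lt1; rewrite fE /len nf_letter.
rewrite -[F2_word [::]]/(1 : F2) aut1 => /(congr1 nf).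
by rewrite nf1 nf_letter.
Qed.

(** Strong induction on the length of the basis reduces to a minimal f. *)
Lemma AutPlusE : AutPlus = mulset (IntAut F2) B3_Aut.
Proof.
have [H1 HM HV] := IntB3_subgroup; have [A1 AM AV] := AutPlus_subgroup.
rewrite eqEsubset; split; last first.
  move=> _ [i Hi] [b Hb] <-; apply: (AM); first exact: IntAut_AutPlus.
  exact: B3_Aut_AutPlus.
move=> f; have [n] := ubnP (len (f F2_u) + len (f F2_v)).
elim: n f => // n IHn f; rewrite ltnS => le_n Af.
have [min_f|] := pselect (nielsen_minimal f).
  have [l fu] := minimal_onto_letters (ord0, true) min_f.
  have [m fv] := minimal_onto_letters (ord_max, true) min_f.
  by rewrite -[f]invgK; apply: (HV); apply: (signed_permutation_IntB3 fu fv); apply: (AV).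
move=> /existsNP[g] /existsNP[x] /negP; rewrite -ltnNge.
set f' : AutGroup F2 := inner g * f * braid_action x => lt_f'.
have Hg : mulset (IntAut F2) B3_Aut (inner g).
  by apply/IntB3P; exists g, 1; rewrite gmulf1 mulg1.
have Hx : mulset (IntAut F2) B3_Aut (braid_action x).
  by apply/IntB3P; exists 1, x; rewrite inner1 mul1g.
have Af' : AutPlus f'.
  by apply: (AM); [apply: (AM) => //; apply: IntAut_AutPlus; exists g
                |apply: B3_Aut_AutPlus; exists x].
have -> : f = (inner g)^-1 * f' * (braid_action x)^-1.
  by rewrite /f' !mulgA mulVg mul1g mulgK.
apply: (HM); last exact: HV.
by apply: (HM); [exact: HV | apply: IHn => //; apply: leq_trans lt_f' _].
Qed.

(** * The kernel of the braid group acting on Z^2 *)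

Definition B3_t : B3 := B3_a * B3_b.
Definition B3_c : B3 := B3_s ^+ 2.

Lemma B3_aE : B3_a = B3_t^-1 * B3_s.
Proof. by rewrite /B3_s -/B3_t mulKg. Qed.

Lemma B3_bE : B3_b = B3_s^-1 * (B3_t * B3_t).
Proof. by apply: (mulgI B3_s); rewrite mulVKg /B3_t /B3_s !mulgA. Qed.

Lemma B3_sa : B3_s * B3_a = B3_b * B3_s.
Proof. by rewrite {1}s_alt /B3_s !mulgA. Qed.

Lemma B3_sb : B3_s * B3_b = B3_a * B3_s.
Proof. by rewrite [in RHS]s_alt /B3_s !mulgA. Qed.

(** Conjugation by s exchanges a and b, so its square is trivial. *)
Lemma B3_c_central x : commute x B3_c.
Proof.
have ca : commute B3_c B3_a.
  by rewrite /commute /B3_c expg2 -mulgA B3_sa mulgA B3_sb -mulgA.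
have cb : commute B3_c B3_b.
  by rewrite /commute /B3_c expg2 -mulgA B3_sb mulgA B3_sa -mulgA.
apply: commute_sym; elim/B3_ind: x => [|x cx|x cx|x cx|x cx].
- exact: commute1.
all: by apply: commuteM cx; rewrite ?[commute _ _^-1]commuteV //; apply: commuteV.
Qed.

Lemma B3_tt_t : B3_t * (B3_t * B3_t) = B3_c.
Proof. by rewrite /B3_c expg2 {1}[B3_s]/B3_s s_alt /B3_t !mulgA. Qed.

Lemma B3_ts : B3_t * B3_s = B3_c * B3_b^-1.
Proof.
apply: (mulIg B3_b); rewrite mulgVK -mulgA B3_sb mulgA -/B3_s.
by rewrite /B3_c expg2.
Qed.

Lemma B3_tbV : B3_t * B3_b^-1 = B3_a.
Proof. by rewrite /B3_t mulgK. Qed.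

Definition pos_word (w : seq bool) : B3 :=
  \prod_(d <- w) (if d then B3_a else B3_b^-1).

Lemma pos_word_cons d w :
  pos_word (d :: w) = (if d then B3_a else B3_b^-1) * pos_word w.
Proof. by rewrite /pos_word big_cons. Qed.

(** Multiplying x by a power of the central element c avoids negative exponents
    of s. *)
Definition has_normal_form (x : B3) : Prop :=
  exists n m w j, j < 3 /\ x * B3_c ^+ n = B3_s ^+ m * (pos_word w * B3_t ^+ j).

Lemma B3_sX m : B3_s ^+ m = B3_c ^+ m./2 * B3_s ^+ odd m.
Proof. by rewrite -expgnA mul2n -expgnDr addnC odd_double_half. Qed.

Lemma normal_form_s x : has_normal_form x -> has_normal_form (B3_s * x).
Proof.
move=> [n [m [w [j [j3 e]]]]]; exists n, m.+1, w, j; split=> //.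
by rewrite -mulgA e mulgA expgS.
Qed.

Lemma normal_form_c x : has_normal_form (B3_c * x) -> has_normal_form x.
Proof.
move=> [n [m [w [j [j3 e]]]]]; exists n.+1, m, w, j; split=> //.
by rewrite expgS mulgA (B3_c_central x).
Qed.

Lemma normal_form_t x : has_normal_form x -> has_normal_form (B3_t * x).
Proof.
move=> [n [m [w [j [j3 e]]]]].
suff [k [w' [j' [j'3 e']]]] : exists k w' j', j' < 3 /\
    B3_t * (B3_s ^+ odd m * (pos_word w * B3_t ^+ j)) =
    B3_s ^+ k * (pos_word w' * B3_t ^+ j').
  exists n, (2 * m./2 + k), w', j'; split=> //.
  rewrite -mulgA e B3_sX -(mulgA (B3_c ^+ _)) (mulgA B3_t).
  rewrite (commuteX _ (B3_c_central _)) -(mulgA (B3_c ^+ _)) e'.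
  by rewrite expgnDr expgnA -mulgA.
case: (odd m).
  exists 2, (false :: w), j; split=> //.
  by rewrite pos_word_cons expg1 mulgA B3_ts -/B3_c !mulgA.
rewrite expg0 mul1g.
case: w {e} => [|[] w].
(* t^3 = c = s^2 *)
- case: (ltnP j.+1 3) => j2.
    by exists 0, [::], j.+1; split=> //; rewrite expg0 /pos_word big_nil !mul1g expgS.
  have -> : j = 2 by lia.
  by exists 2, [::], 0; split=> //; rewrite /pos_word big_nil !mul1g expg2 B3_tt_t mulg1.
- by exists 1%N, w, j; split=> //; rewrite pos_word_cons expg1 !mulgA -/B3_s.
- by exists 0, (true :: w), j; split=> //; rewrite !pos_word_cons expg0 mul1g !mulgA B3_tbV.
Qed.

(** The normal forms are stable under left multiplication by s and t, hence by
    their inverses s c^-1 and t^2 c^-1, and these generate B_3. *)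
Lemma normal_form x : has_normal_form x.
Proof.
have nfsV y : has_normal_form y -> has_normal_form (B3_s^-1 * y).
  move=> Hy; apply: normal_form_c; rewrite mulgA /B3_c expg2 mulgK.
  exact: normal_form_s.
have nftV y : has_normal_form y -> has_normal_form (B3_t^-1 * y).
  move=> Hy; apply: normal_form_c.
  rewrite -B3_tt_t mulgA mulgA mulgK -mulgA.
  by do 2!apply: normal_form_t.
elim/B3_ind: x => [|x nx|x nx|x nx|x nx].
- by exists 0, 0, [::], 0; rewrite /pos_word big_nil !expg0 !mulg1.
- by rewrite B3_aE -(mulgA B3_t^-1); apply/nftV/normal_form_s.
- by rewrite B3_aE invgM invgK -(mulgA B3_s^-1); apply/nfsV/normal_form_t.
- by rewrite B3_bE -(mulgA B3_s^-1) -(mulgA B3_t); apply/nfsV/normal_form_t/normal_form_t.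
- rewrite B3_bE (invgM B3_s^-1) invgK (invgM B3_t B3_t) -(mulgA _ B3_s) -(mulgA B3_t^-1).
  by apply/nftV/nftV/normal_form_s.
Qed.

Definition rhoB (x : B3) : 'M[int]_2 := rho (braid_action x).

Lemma rhoBM x y : rhoB (x * y) = (rhoB x *m rhoB y)%R.
Proof. by rewrite /rhoB gmulfM rhoM. Qed.

Lemma rhoB1 : rhoB 1 = mx2 1 0 0 1.
Proof. by rewrite /rhoB gmulf1 rho1 mx2_scalar. Qed.

Lemma rhoB_a : rhoB B3_a = mx2 1 (-1) 0 1. Proof. exact: rho_a. Qed.

Lemma rhoB_b : rhoB B3_b = mx2 1 0 1 1. Proof. exact: rho_b. Qed.

Lemma rhoB_bV : rhoB B3_b^-1 = mx2 1 0 (-1) 1.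
Proof.
have : (rhoB B3_b^-1 *m rhoB B3_b *m mx2 1 0 (-1) 1 = mx2 1 0 (-1) 1)%R.
  by rewrite -rhoBM mulVg rhoB1 -mx2_scalar mul1mx.
by rewrite -mulmxA /rhoB rho_b mx2M -[X in (_ *m X)%R]/(mx2 1 0 0 1) -mx2_scalar mulmx1.
Qed.

Lemma rhoB_t : rhoB B3_t = mx2 0 (-1) 1 1.
Proof. by rewrite rhoBM /rhoB rho_a rho_b mx2M. Qed.

Lemma rhoB_s : rhoB B3_s = mx2 0 (-1) 1 0.
Proof. by rewrite rhoBM -/B3_t rhoB_t /rhoB rho_a mx2M. Qed.

Lemma rhoB_c n : rhoB (B3_c ^+ n) = (((-1) ^+ n)%:M)%R.
Proof.
elim: n => [|n IHn]; first by rewrite expg0 rhoB1 mx2_scalar.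
rewrite expgS rhoBM IHn /B3_c expg2 rhoBM rhoB_s mx2M.
rewrite -[mx2 _ _ _ _]/(mx2 (-1) 0 0 (-1)) -mx2_scalar -scalar_mxM.
by rewrite exprS.
Qed.

(** The sign pattern is that of a nonnegative matrix conjugated by diag(1, -1);
    a nonempty word has a nonzero off-diagonal entry. *)
Lemma rhoB_pos_word v : exists p q r w : int, rhoB (pos_word v) = mx2 p q r w /\
  (1 <= p /\ 1 <= w /\ q <= 0 /\ r <= 0 /\ (v != [::] -> q + r < 0))%R.
Proof.
elim: v => [|d v [p [q [r [w [e ineq]]]]]].
  by exists 1%R, 0%R, 0%R, 1%R; rewrite /pos_word big_nil rhoB1.
rewrite pos_word_cons; case: d; rewrite rhoBM e.
  rewrite rhoB_a mx2M.
  by do 4!eexists; split; first reflexivity; lia.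
rewrite rhoB_bV mx2M.
by do 4!eexists; split; first reflexivity; lia.
Qed.

(** In each of the six cases for the exponents of s and t, the sign pattern of
    the positive word gives an off-diagonal entry that cannot vanish, except
    when both exponents are zero and the word is empty. *)
Lemma rhoB_scalar_core (d : bool) v j z : j < 3 ->
  rhoB (B3_s ^+ d * (pos_word v * B3_t ^+ j)) = (z%:M)%R ->
  [/\ d = false, v = [::] & j = 0].
Proof.
move=> j3; have [p [q [r [w [e ineq]]]]] := rhoB_pos_word v.
rewrite expgb !rhoBM e mx2_scalar.
case: d; rewrite ?rhoB1 ?rhoB_s;
  case: j j3 => [|[|[|j]]] // _; rewrite ?expg0 ?expg1 ?expg2 ?rhoBM ?rhoB1
    ?rhoB_a ?rhoB_b !mx2M;
  move=> /mx2_inj[e1 e2 e3 e4]; try by exfalso; lia.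
split=> //; apply/eqP/contraT => v0.
by have [_ [_ [_ [_ /(_ v0)]]]] := ineq; lia.
Qed.

Lemma rhoB_scalar x z : rhoB x = (z%:M)%R -> exists n k, x * B3_c ^+ n = B3_c ^+ k.
Proof.
move=> xz; have [n [m [w [j [j3 e]]]]] := normal_form x.
have := congr1 rhoB e; rewrite B3_sX -mulgA rhoBM xz rhoB_c [in RHS]rhoBM rhoB_c.
(* Multiplying by (-1)^(m./2) again removes the factor c^(m./2). *)
set y := (_ * (_ * _)) => /(congr1 (mulmx ((-1) ^+ m./2)%:M)).
rewrite -!scalar_mxM mulmxA -scalar_mxM -exprMn mulrNN mulr1 expr1n mul1mx => /esym.
move=> /(rhoB_scalar_core j3)[d0 w0 j0].
exists n, m./2; rewrite e B3_sX d0 w0 j0.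
by rewrite /pos_word big_nil !expg0 !mulg1.
Qed.

(** * Powers of s^4 *)

Definition B3_s4 : B3 := B3_s ^+ 4.

Lemma B3_s4X n : B3_s4 ^+ n = B3_c ^+ n.*2.
Proof. by rewrite /B3_s4 /B3_c -!expgnA; congr (_ ^+ _); lia. Qed.

(** A braid with trivial matrix is a quotient of powers of c by [rhoB_scalar];
    as c acts by -1, the difference of the exponents is even. *)
Lemma rhoB_kernel x : rhoB x = (1%:M)%R ->
  exists n, x = B3_s4 ^+ n \/ x = (B3_s4 ^+ n)^-1.
Proof.
move=> x1; have [n [k e]] := rhoB_scalar x1.
have : (((-1) ^+ n)%:M = ((-1) ^+ k)%:M :> 'M[int]_2)%R.
  by rewrite -!rhoB_c -e rhoBM x1 mul1mx.
rewrite !mx2_scalar => /mx2_inj[nk _ _ _].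
have {nk} par : odd n = odd k.
  by move: nk; rewrite -signr_odd -(signr_odd _ k); case: (odd n); case: (odd k).
have {e} -> : x = B3_c ^+ k * (B3_c ^+ n)^-1 by rewrite -e mulgK.
case: (leqP n k) => nk; [exists (k - n)./2; left | exists (n - k)./2; right].
  rewrite B3_s4X even_halfK ?oddB ?par ?addbb //.
  by rewrite expgnFr.
rewrite B3_s4X even_halfK ?oddB ?(ltnW nk) ?par ?addbb //.
by rewrite expgnFr ?(ltnW nk) // invgM invgK.
Qed.

Definition uv_comm : F2 := F2_v^-1 * F2_u^-1 * F2_v * F2_u.

Lemma braid_actionM x y : braid_action (x * y) = braid_action x * braid_action y.
Proof. exact: gmulfM. Qed.

Lemma braid_actionV x : braid_action x^-1 = (braid_action x)^-1.
Proof. exact: gmulfV. Qed.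

Lemma braid_action1 : braid_action 1 = 1.
Proof. exact: gmulf1. Qed.

Lemma braid_action_s4 : braid_action B3_s4 = inner uv_comm.
Proof.
apply/autP/F2_morph_eq; [exact: aut_morph|exact: aut_morph| |].
all: rewrite /B3_s4 !expgS expg0 mulg1 !(braid_actionM B3_s) !(aut_mulE (braid_action B3_s)).
all: rewrite !(act_s_u, act_s_v, aut_morph (braid_action B3_s), autV (braid_action B3_s)).
all: rewrite /= conjgE /uv_comm ?invgM ?invgK !mulgA.
all: by rewrite ?(mulgVK, mulgK, mulVg, mul1g).
Qed.

Lemma braid_action_s4X n : braid_action (B3_s4 ^+ n) = inner (uv_comm ^+ n).
Proof.
elim: n => [|n IHn]; first by rewrite !expg0 inner1 braid_action1.
by rewrite expgS expgSr (braid_actionM B3_s4) IHn braid_action_s4 innerM.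
Qed.

(** The powers of v^-1 u^-1 v u are reduced as they stand, and so are their
    products by u on either side; these begin with different letters. *)
Lemma uv_comm_expg_neq n : F2_u ^ (uv_comm ^+ n.+1) <> F2_u.
Proof.
pose cw : word 'I_2 := [:: (ord_max, false); (ord0, false); (ord_max, true); (ord0, true)].
pose w k := flatten (nseq k cw).
have cwE : uv_comm = F2_word cw.
  by rewrite !F2_word_cons !letterE /F2_word [class_of _ _]/(1 : F2) mulg1 !mulgA.
have wE k : uv_comm ^+ k = F2_word (w k).
  by elim: k => // k IHk; rewrite expgS IHk cwE -F2_word_cat.
have red_w k s : reduced ((ord0, true) :: s) -> reduced ((ord0, true) :: w k ++ s).
  by move=> rs; elim: k => // k; rewrite /w /= => ->.
move=> /(congr1 (fun x => uv_comm ^+ n.+1 * x)); rewrite conjgE mulVKg.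
rewrite wE -letter_u -!F2_word_cat => /(congr1 nf).
rewrite nf_F2_word_reduced ?nf_F2_word_reduced //.
  exact: (path_sorted (red_w n.+1 [:: (ord0, true)] isT)).
by have := red_w n.+1 [::] isT; rewrite cats0.
Qed.

(** A braid in the kernel acts trivially on Z^2, hence is a power of s^4, which
    acts as conjugation by a power of a commutator. *)
Lemma braid_action_inj : injective braid_action.
Proof.
move=> x y exy; apply/eqP; rewrite -[y]invgK -mulg_eq1; apply/eqP.
have a1 : braid_action (x * y^-1) = 1 by rewrite braid_actionM braid_actionV exy mulgV.
have : rhoB (x * y^-1) = (1%:M)%R by rewrite /rhoB a1 rho1.
case/rhoB_kernel => n e.
have {a1} : inner (uv_comm ^+ n) = 1.
  rewrite -braid_action_s4X; case: e => e; first by rewrite -e.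
  by rewrite -[B3_s4 ^+ n]invgK -e braid_actionV a1 invg1.
case: n e => [|n] e; first by case: e => ->; rewrite expg0 ?invg1.
by move=> /(congr1 (fun f : AutGroup F2 => f F2_u)) /uv_comm_expg_neq.
Qed.

Lemma IntAut_s4X n : IntAut F2 (braid_action (B3_s4 ^+ n)).
Proof. by exists (uv_comm ^+ n) => //; rewrite braid_action_s4X. Qed.

Lemma rhoB_kernel_IntAut x : rhoB x = (1%:M)%R -> IntAut F2 (braid_action x).
Proof.
have [_ _ IV] := IntAut_subgroup.
by case/rhoB_kernel => n [] ->; rewrite ?braid_actionV; [|apply: IV]; apply: IntAut_s4X.
Qed.

(** Factor an element of the kernel as an inner automorphism times a braid: the
    braid acts trivially on Z^2, so it is a power of s^4 and acts as an inner
    automorphism. *)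
Lemma IntAut_ker : IntAut F2 = ker_rho_plus.
Proof.
rewrite eqEsubset; split=> f.
  by move=> If; split; [exact: IntAut_AutPlus | case: If => g _ <-; exact: rho_inner].
move=> [Af r1]; move: Af r1; rewrite AutPlusE => /IntB3P[g [x ->]].
rewrite rhoM rho_inner mul1mx => /rhoB_kernel_IntAut Ix.
by have [_ IM _] := IntAut_subgroup; apply: IM => //; exists g.
Qed.

Lemma IntB3_capP f : (IntAut F2 `&` B3_Aut) f <-> B3_Aut f /\ rho f = (1%:M)%R.
Proof.
rewrite IntAut_ker; split=> [[[_ r1] Bf]|[Bf r1]]; split=> //.
by split=> //; exact: B3_Aut_AutPlus.
Qed.

Lemma IntB3_cap_subgroup : is_subgroup (IntAut F2 `&` B3_Aut).
Proof.
have [I1 IM IV] := IntAut_subgroup; have [B1 BM BV] := B3_Aut_subgroup.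
split; first by split.
- by move=> f g [If Bf] [Ig Bg]; split; [exact: IM|exact: BM].
- by move=> f [If Bf]; split; [exact: IV|exact: BV].
Qed.

Lemma IntB3_cap : IntAut F2 `&` B3_Aut = subgroup_gen [set braid_action B3_s4].
Proof.
rewrite eqEsubset; split; last first.
  apply: smallest_sub; first exact: IntB3_cap_subgroup.
  by move=> _ ->; split; [exact: (IntAut_s4X 1) | exists B3_s4].
move=> _ /IntB3_capP[[x _ <-] /rhoB_kernel[n xz]] D [[D1 DM DV] zD].
have Dn : D (braid_action (B3_s4 ^+ n)).
  elim: n {xz} => [|n IHn]; first by rewrite expg0 braid_action1.
  by rewrite expgS (braid_actionM B3_s4); apply: (DM) => //; apply: zD.
by case: xz => ->; rewrite ?braid_actionV //; apply: DV.
Qed.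

(** A matrix that commutes with both elementary matrices is scalar. *)
Lemma center_rho f : center_of B3_Aut f ->
  rho f = (1%:M)%R \/ rho f = ((-1)%:M)%R.
Proof.
move=> [Bf cf].
have := congr1 rho (cf _ (ex_intro2 _ _ B3_a I erefl)).
have := congr1 rho (cf _ (ex_intro2 _ _ B3_b I erefl)).
rewrite !rhoM rho_a rho_b; have := B3_Aut_AutPlus Bf; rewrite /AutPlus /SL2Z /=.
rewrite [rho f]mx2_eta; move: (rho f _ _) (rho f _ _) (rho f _ _) (rho f _ _) => p q r w.
rewrite det_mx2 !mx2M => det /mx2_inj[b1 b2 b3 b4] /mx2_inj[a1 a2 a3 a4].
have [r0 q0 wp] : [/\ r = 0, q = 0 & w = p]%R by split; lia.
rewrite !mx2_scalar r0 q0 wp; move: det; rewrite r0 q0 wp.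
rewrite mulr0 subr0 -expr2 => /eqP; rewrite sqrf_eq1 => /orP[] /eqP ->; by [left|right].
Qed.

Lemma rho_scalar_center x z : rhoB x = (z%:M)%R -> center_of B3_Aut (braid_action x).
Proof.
case/rhoB_scalar => n [k e]; split; first by exists x.
move=> _ [y _ <-]; apply: gmulf_commute.
have -> : x = B3_c ^+ k * (B3_c ^+ n)^-1 by rewrite -e mulgK.
apply/commute_sym/commuteM; first exact/commuteX/B3_c_central.
exact/commuteV/commuteX/B3_c_central.
Qed.

Lemma left_coset_eq (G : groupType) (H : set G) x y :
  is_subgroup H -> H (x^-1 * y) -> left_coset x H = left_coset y H.
Proof.
move=> [H1 HM HV] Hxy; rewrite eqEsubset; split=> _ [h Hh <-].
  exists (y^-1 * x * h); last by rewrite !mulgA mulgV mul1g.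
  by apply: HM => //; rewrite -[y^-1 * x]invgK invgM invgK; apply: HV.
by exists (x^-1 * y * h); [exact: HM | rewrite !mulgA mulgV mul1g].
Qed.

Lemma index_two_subgroupI (G : groupType) (H K : set G) c :
  is_subgroup H -> H `<=` K -> K c -> ~ H c ->
  (forall x, K x -> H x \/ H (c^-1 * x)) -> index_two_subgroup H K.
Proof.
move=> sH HK Kc Hc Kx; split=> //; have [H1 HM HV] := sH.
have inH x : left_coset x H = H -> H x.
  by move=> e; rewrite -e; exists 1 => //; rewrite mulg1.
have H1E : left_coset 1 H = H.
  by rewrite eqEsubset; split=> [_ [h Hh <-]|h Hh]; [rewrite mul1g | exists h; rewrite ?mul1g].
have Hx1 x : H x -> left_coset x H = H.
  by move=> Hx; rewrite -[RHS]H1E; apply: left_coset_eq => //; rewrite mulg1; apply: HV.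
have cosetP x : K x -> left_coset x H = H \/ left_coset x H = left_coset c H.
  case/Kx => [Hx|Hcx]; [left; exact: Hx1|right].
  by apply/esym/left_coset_eq.
apply/card_set_bijP; exists (fun C => if `[< C = H >] then 0 else 1%N); split.
- by move=> _ [x _ <-] /=; case: ifP.
- move=> _ _ /set_mem[x Kx' <-] /set_mem[y Ky <-].
  case: asboolP => [->|nx]; case: asboolP => [->|ny] // _.
  by case: (cosetP x Kx') => // ->; case: (cosetP y Ky) => // ->.
- move=> [|[|]] // _.
    exists H; first by exists 1; [exact: HK | exact: H1E].
    by rewrite asboolT.
  exists (left_coset c H); first by exists c.
  by rewrite asboolF // => /inH.
Qed.

Lemma IntB3_cap_index_two :
  index_two_subgroup (IntAut F2 `&` B3_Aut) (center_of B3_Aut).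
Proof.
have rc : rhoB B3_c = ((-1)%:M)%R by have := rhoB_c 1; rewrite expg1 expr1.
apply: (@index_two_subgroupI _ _ _ (braid_action B3_c)).
- exact: IntB3_cap_subgroup.
- by move=> f /IntB3_capP[[x _ <-] r1]; apply: rho_scalar_center r1.
- exact: rho_scalar_center rc.
- move=> /IntB3_capP[_]; rewrite -/(rhoB _) rc => /matrixP/(_ ord0 ord0).
  by rewrite !mxE.
- move=> f cf; have [[x _ fx] _] := cf; subst f.
  case: (center_rho cf) => r; [left|right]; apply/IntB3_capP; split=> //; first by exists x.
    by exists (B3_c^-1 * x) => //; rewrite braid_actionM braid_actionV.
  rewrite -braid_actionV -braid_actionM -/(rhoB _) rhoBM [rhoB x]r -rc -rhoBM mulVg.
  by rewrite /rhoB braid_action1 rho1.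
Qed.

Lemma IntB3_generate : subgroup_gen (IntAut F2 `|` B3_Aut) = AutPlus.
Proof.
rewrite eqEsubset; split.
  apply: smallest_sub; first exact: AutPlus_subgroup.
  by move=> f [/IntAut_AutPlus|/B3_Aut_AutPlus].
rewrite AutPlusE => _ [i Hi] [b Hb] <- D [[D1 DM DV] IBD].
by apply: DM; apply: IBD; [left|right].
Qed.

Theorem mainTheorem1 :
  injective braid_action /\
  (IntAut F2 `&` B3_Aut = subgroup_gen [set braid_action (B3_s ^+ 4)] /\
   index_two_subgroup (IntAut F2 `&` B3_Aut) (center_of B3_Aut)) /\
  IntAut F2 = ker_rho_plus /\
  (subgroup_gen (IntAut F2 `|` B3_Aut) = AutPlus /\
   AutPlus = mulset (IntAut F2) B3_Aut).
Proof.
split; first exact: braid_action_inj.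
split; first by split; [exact: IntB3_cap | exact: IntB3_cap_index_two].
split; first exact: IntAut_ker.
by split; [exact: IntB3_generate | exact: AutPlusE].
Qed.
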